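(* Let $\mathcal G_0$ be the initial mesh. Any sequence of admissible meshes $\mathcal G_0,\mathcal G_1,\dots,\mathcal G_J$ with $\mathcal G_j=\operatorname{ref}^{\mathbf p,m}(\mathcal G_{j-1},\mathcal M_{j-1})$, $\mathcal M_{j-1}\subseteq\mathcal G_{j-1}$ for $j\in\{1,\dots,J\}$, satisfies $$|\mathcal G_J\setminus\mathcal G_0|\le C_{\mathbf p,m}\sum_{j=0}^{J-1}|\mathcal M_j|,$$ where $|\cdot|$ denotes cardinality, with $$C_{\mathbf p,m}=\frac{m^{1/3}}{1-m^{-1/3}}\,(4d_1+1)\,(4d_2+m^{1/3})\,(4d_3+m^{2/3}),$$ $$d_1=\tfrac{1}{1-m^{-1/3}}\Bigl(p_1+\tfrac{3+m^{1/3}}2+\tfrac{m^{1/3}-1}{m^2}\Bigr),\quad d_2=\tfrac{m^{1/3}}{1-m^{-1/3}}\Bigl(p_2+\tfrac{3+m^{1/3}}2+\tfrac{m^{1/3}-1}{m^2}\Bigr),\quad d_3=\tfrac{m^{2/3}}{1-m^{-1/3}}\Bigl(p_3+\tfrac{3+m^{1/3}}2+\tfrac{m^{1/3}-1}{m^2}\Bigr).$$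
   Context: Parameters: $\mathbf p=(p_1,p_2,p_3)$ with each $p_i\ge 3$ an odd integer; $m\ge2$ an integer (grading parameter); positive integers $\tilde X,\tilde Y,\tilde Z$. Initial mesh: $\mathcal G_0=\{[x-1,x]\times[y-1,y]\times[z-1,z] : x\in\{1,\dots,\tilde X\},y\in\{1,\dots,\tilde Y\},z\in\{1,\dots,\tilde Z\}\}$, partitioning $\Omega=(0,\tilde X)\times(0,\tilde Y)\times(0,\tilde Z)$. Elements are closed axis-parallel boxes arising from elements of $\mathcal G_0$ by successive subdivision as below. The level of an element $K$ is $\ell(K)=-\log_m|K|$ ($|K|$ = volume), so elements of $\mathcal G_0$ have level $0$ and children of $K$ have level $\ell(K)+1$. Subdivision: for an element $K$, $\operatorname{child}(K)$ is the set of the $m$ boxes obtained by cutting $K$ into $m$ congruent boxes by planes orthogonal to the $x$-axis if $\ell(K)\equiv0$, to the $y$-axis if $\ell(K)\equiv1$, to the $z$-axis if $\ell(K)\equiv2\pmod 3$. For $K\in\mathcal G$, $\operatorname{subdiv}(\mathcal G,K)=(\mathcal G\setminus\{K\})\cup\operatorname{child}(K)$; for $\mathcal M=\{K_1,\dots,K_J\}\subseteq\mathcal G$, $\operatorname{subdiv}(\mathcal G,\mathcal M)$ is the result of successively subdividing all $K_j$ (in any order). Patches: for $x\in\overline\Omega$, $\operatorname{Dist}(K,x)\in\mathbb R^3$ is the componentwise absolute value of $\operatorname{mid}(K)-x$, with $\operatorname{mid}(K)$ the midpoint of $K$. For $k\ge0$, $$\mathbf D^{\mathbf p,m}(k)=\begin{cases}m^{-k/3}(p_1+\frac32,\,p_2+\frac32,\,p_3+\frac32)&k\equiv0\bmod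 3,\\ m^{-(k-1)/3}(\frac{p_1+3/2}m,\,p_2+\frac32,\,p_3+\frac32)&k\equiv1\bmod 3,\\ m^{-(k-2)/3}(\frac{p_1+3/2}m,\,\frac{p_2+3/2}m,\,p_3+\frac32)&k\equiv2\bmod 3.\end{cases}$$ Set $U^{\mathbf p,m}(K)=\{x\in\Omega:\operatorname{Dist}(K,x)<\mathbf D^{\mathbf p,m}(\ell(K))\}$ (componentwise inequality), and the $(\mathbf p,m)$-patch $\mathcal G^{\mathbf p,m}(K)=\{K'\in\mathcal G: K'\cap U^{\mathbf p,m}(K)\ne\emptyset\}$. Admissibility: for $K\in\mathcal G$, the subdivision $\operatorname{subdiv}(\mathcal G,K)$ is admissible if $\ell(K')\ge\ell(K)$ for all $K'\in\mathcal G^{\mathbf p,m}(K)$. For $\mathcal M=\{K_1,\dots,K_J\}\subseteq\mathcal G$, $\operatorname{subdiv}(\mathcal G,\mathcal M)$ is admissible if for some ordering of the $K_j$ it is a concatenation of admissible subdivisions of single elements. A mesh is admissible if it is $\mathcal G_0$ or is obtained from $\mathcal G_0$ by a finite sequence of admissible subdivisions $\mathcal G_{j+1}=\operatorname{subdiv}(\mathcal G_j,\mathcal M_j)$, $\mathcal M_j\subseteq\mathcal G_j$. Refinement algorithm: for a mesh $\mathcal G$ and $\mathcal M\subseteq\mathcal G$, the closure $\operatorname{clos}^{\mathbf p,m}(\mathcal G,\mathcal M)$ is obtained by starting with $\widetilde{\mathcal M}=\mathcal M$ and repeatedly, for all $K\in\widetilde{\mathcal M}$, replacing $\widetilde{\mathcal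 M}$ by $\widetilde{\mathcal M}\cup\{K'\in\mathcal G^{\mathbf p,m}(K):\ell(K')<\ell(K)\}$, until $\widetilde{\mathcal M}$ stops growing. Then $\operatorname{ref}^{\mathbf p,m}(\mathcal G,\mathcal M)=\operatorname{subdiv}(\mathcal G,\operatorname{clos}^{\mathbf p,m}(\mathcal G,\mathcal M))$. *)

(* Defs.v *)
From HB Require Import structures.
From mathcomp Require Import all_boot all_order all_algebra.
From mathcomp Require Import finmap.
From mathcomp Require Import all_classical all_reals all_analysis.

Set Implicit Arguments.
Unset Strict Implicit.
Unset Printing Implicit Defensive.

Import Order.TTheory GRing.Theory Num.Theory.

Local Open Scope fset_scope.
Local Open Scope ring_scope.

(* The axes x, y, z are the indices 0, 1, 2 : 'I_3, and p, X : 'I_3 -> nat are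
   the triples (p_1, p_2, p_3) and (X, Y, Z). *)

(* The pair K stands for the closed box [K.1, K.2]. *)
Notation box R := ('rV[R]_3 * 'rV[R]_3)%type.

Definition in_box (R : realType) (K : box R) (x : 'rV[R]_3) : Prop :=
  forall i, K.1 0 i <= x 0 i <= K.2 0 i.

Definition in_domain (R : realType) (X : 'I_3 -> nat) (x : 'rV[R]_3) : Prop :=
  forall i, 0 < x 0 i < (X i)%:R.

Definition vol (R : realType) (K : box R) : R := \prod_i (K.2 0 i - K.1 0 i).

Definition mid (R : realType) (K : box R) : 'rV[R]_3 :=
  \row_i ((K.1 0 i + K.2 0 i) / 2).

Definition dist (R : realType) (K : box R) (x : 'rV[R]_3) : 'rV[R]_3 :=
  \row_i `|mid K 0 i - x 0 i|.

(* Truncation only serves to land in nat: - log_m |K| is a natural number for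
   the elements that occur in meshes, see [natr_level]. *)
Definition level (R : realType) (m : nat) (K : box R) : nat :=
  Num.truncn (- (ln (vol K) / ln (m%:R : R))).

(* Here c is the corner of the cube with the smallest coordinates, so that c i
   plays the role of x - 1 for x in {1, ..., X i}. *)
Definition initial_mesh (R : realType) (X : 'I_3 -> nat) : {fset box R} :=
  [fset ((\row_i (c i)%:R, \row_i (c i).+1%:R) : box R)
     | c : {dffun forall i : 'I_3, 'I_(X i)} in predT].

Definition slice (R : realType) (m : nat) (K : box R) (a : 'I_3) (j : nat) :
    box R :=
  let cut n := K.1 0 a + n%:R * ((K.2 0 a - K.1 0 a) / m%:R) in
  (\row_i (if i == a then cut j else K.1 0 i),
   \row_i (if i == a then cut j.+1 else K.2 0 i)).

Definition child (R : realType) (m : nat) (K : box R) : {fset box R} :=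
  [fset slice m K (inord (level m K %% 3)) j | j in iota 0 m].

Definition subdiv (R : realType) (m : nat) (G : {fset box R}) (K : box R) :
    {fset box R} :=
  (G `\ K) `|` child m K.

(* The enumeration order of M is immaterial: the elements of a mesh have
   disjoint interiors, so no element of M is a descendant of another one. *)
Definition subdivs (R : realType) (m : nat) (G M : {fset box R}) :
    {fset box R} :=
  foldl (subdiv m) G (enum_fset M).

(* The three cases of the definition of D(k) in one formula: with q = k %/ 3,
   entry i is m^-q (p_i + 3/2), divided by m once more when i < k %% 3. *)
Definition patch_size (R : realType) (p : 'I_3 -> nat) (m k : nat) : 'rV[R]_3 :=
  \row_i (m%:R ^- (k %/ 3) *
          (if (i < k %% 3)%N then ((p i)%:R + 3 / 2) / m%:R
           else (p i)%:R + 3 / 2)).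

Definition in_U (R : realType) (X p : 'I_3 -> nat) (m : nat) (K : box R)
    (x : 'rV[R]_3) : Prop :=
  in_domain X x /\ forall i, dist K x 0 i < patch_size R p m (level m K) 0 i.

Definition patch (R : realType) (X p : 'I_3 -> nat) (m : nat)
    (G : {fset box R}) (K : box R) : {fset box R} :=
  [fset K' in G | `[< exists x, in_box K' x /\ in_U X p m K x >]].

Definition admissible_subdiv (R : realType) (X p : 'I_3 -> nat) (m : nat)
    (G : {fset box R}) (K : box R) : Prop :=
  K \in G /\
  forall K', K' \in patch X p m G K -> (level m K <= level m K')%N.

Fixpoint admissible_seq (R : realType) (X p : 'I_3 -> nat) (m : nat)
    (G : {fset box R}) (s : seq (box R)) : Prop :=
  if s is K :: s' then
    admissible_subdiv X p m G K /\ admissible_seq X p m (subdiv m G K) s'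
  else True.

Definition admissible_subdivs (R : realType) (X p : 'I_3 -> nat) (m : nat)
    (G M : {fset box R}) : Prop :=
  exists s : seq (box R), perm_eq s (enum_fset M) /\ admissible_seq X p m G s.

Inductive admissible (R : realType) (X p : 'I_3 -> nat) (m : nat) :
    {fset box R} -> Prop :=
| admissible_initial : admissible X p m (initial_mesh R X)
| admissible_step (G M : {fset box R}) :
    admissible X p m G -> M `<=` G -> admissible_subdivs X p m G M ->
    admissible X p m (subdivs m G M).

Definition clos_step (R : realType) (X p : 'I_3 -> nat) (m : nat)
    (G M : {fset box R}) : {fset box R} :=
  M `|` [fset K' in G | has (fun K => (K' \in patch X p m G K) &&
                                      (level m K' < level m K)%N)
                            (enum_fset M)].

(* For M `<=` G the iteration is stationary after #|`G| steps, see
   [clos_stable]. *)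
Definition clos (R : realType) (X p : 'I_3 -> nat) (m : nat)
    (G M : {fset box R}) : {fset box R} :=
  iter #|` G| (clos_step X p m G) M.

Definition ref (R : realType) (X p : 'I_3 -> nat) (m : nat)
    (G M : {fset box R}) : {fset box R} :=
  subdivs m G (clos X p m G M).

Definition d_const (R : realType) (p : 'I_3 -> nat) (m : nat) (i : 'I_3) : R :=
  let q : R := m%:R `^ (1 / 3) in
  m%:R `^ (i%:R / 3) / (1 - m%:R `^ (- (1 / 3))) *
  ((p i)%:R + (3 + q) / 2 + (q - 1) / m%:R ^+ 2).

Definition C_const (R : realType) (p : 'I_3 -> nat) (m : nat) : R :=
  m%:R `^ (1 / 3) / (1 - m%:R `^ (- (1 / 3))) *
  (4 * d_const R p m 0 + 1) *
  (4 * d_const R p m 1 + m%:R `^ (1 / 3)) *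
  (4 * d_const R p m 2 + m%:R `^ (2 / 3)).

Lemma ln_vol_level (R : realType) (m k : nat) (K : box R) :
  (1 < m)%N -> vol K = m%:R ^- k -> - (ln (vol K) / ln (m%:R : R)) = k%:R.
Proof.
move=> m_gt1 ->.
have m0 : 0 < m%:R :> R by rewrite ltr0n ltnW.
have l0 : ln (m%:R : R) != 0 by rewrite gt_eqF// ln_gt0// ltr1n.
rewrite lnV ?posrE ?exprn_gt0// lnXn// mulNr opprK -[ln _ *+ k]mulr_natl mulfK//.
Qed.

Lemma vol_slice (R : realType) (m j : nat) (a : 'I_3) (K : box R) :
  vol (slice m K a j) = vol K / m%:R.
Proof.
rewrite /vol (bigD1 a)//= (bigD1 (F := fun i => K.2 0 i - K.1 0 i) a)//=.
rewrite !mxE eqxx [RHS]mulrAC; congr (_ * _).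
  rewrite opprD addrACA subrr add0r.
  by rewrite -mulrBl -natrB ?leqnSn// subSnn mul1r.
by apply: eq_bigr => i /negPf ia; rewrite !mxE ia.
Qed.

Lemma vol_admissible (R : realType) (X p : 'I_3 -> nat) (m : nat)
    (G : {fset box R}) (K : box R) :
  (1 < m)%N -> admissible X p m G -> K \in G ->
  exists k : nat, vol K = m%:R ^- k.
Proof.
move=> m_gt1 adG; elim: adG K => [K|{}G M _ IH MG _ K].
  move=> /imfsetP[c _ ->]; exists 0%N; rewrite /vol expr0 invr1.
  by rewrite big1// => i _; rewrite !mxE -natrB// subSnn.
have foldP (s : seq (box R)) (H : {fset box R}) :
    (forall K, K \in s -> exists k : nat, vol K = m%:R ^- k) ->
    (forall K, K \in H -> exists k : nat, vol K = m%:R ^- k) ->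
    forall K, K \in foldl (subdiv m) H s -> exists k : nat, vol K = m%:R ^- k.
  elim: s H => //= L s IHs H Ls HH; apply: IHs.
    by move=> L' sL'; apply: Ls; rewrite inE sL' orbT.
  move=> L'; rewrite in_fsetU => /orP[/fsetD1P[_ /HH//]|/imfsetP[j _ ->]].
  have [k volL] := Ls L (mem_head _ _).
  by exists k.+1; rewrite vol_slice volL exprSr invfM.
apply: foldP; last exact: IH.
by move=> L LM; apply: IH; apply: (fsubsetP MG).
Qed.

Lemma natr_level (R : realType) (X p : 'I_3 -> nat) (m : nat)
    (G : {fset box R}) (K : box R) :
  (1 < m)%N -> admissible X p m G -> K \in G ->
  (level m K)%:R = - (ln (vol K) / ln (m%:R : R)).
Proof.
move=> m_gt1 adG /(vol_admissible m_gt1 adG)[k volK].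
by rewrite /level (ln_vol_level m_gt1 volK) natrK.
Qed.

Lemma clos_stable (R : realType) (X p : 'I_3 -> nat) (m : nat)
    (G M : {fset box R}) :
  M `<=` G -> clos_step X p m G (clos X p m G M) = clos X p m G M.
Proof.
move=> MG; pose f n := iter n (clos_step X p m G) M.
have fG n : f n `<=` G.
  elim: n => //= n IHn; rewrite fsubUset IHn /=.
  by apply/fsubsetP => K; rewrite !inE => /andP[].
have fS n : f n `<=` f n.+1 by rewrite /= fsubsetUl.
have fP n : f n.+1 = f n \/ (n < #|` f n.+1|)%N.
  elim: n => [|n [IHn|IHn]].
  - have [->|neq] := eqVneq (f 1%N) (f 0%N); [by left|right].
    by rewrite (leq_ltn_trans _ (fproper_ltn_card (_ : f 0%N `<` _)))//
      fproperEneq eq_sym neq fS.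
  - by left; rewrite /= [in LHS]/= -/(f n) in IHn *; rewrite -/(f n.+1) IHn.
  - have [->|neq] := eqVneq (f n.+2) (f n.+1); [by left|right].
    by rewrite (leq_ltn_trans IHn)// fproper_ltn_card// fproperEneq eq_sym neq fS.
have [//|] := fP #|` G|.
by rewrite ltnNge fsubset_leq_card.
Qed.

(* Main.v *)
Require Import Defs.
From mathcomp Require Import all_boot all_order all_algebra.
From mathcomp Require Import finmap zify ring lra.
From mathcomp Require Import all_classical all_reals all_analysis.

Set Implicit Arguments.
Unset Strict Implicit.
Unset Printing Implicit Defensive.

Import Order.TTheory GRing.Theory Num.Theory.

Local Open Scope fset_scope.
Local Open Scope ring_scope.

(** Write q for the cube root of m.  The proof is a charging argument: every
    element K of the last mesh that is not initial collects a total charge of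
    at least 1 from the marked elements L ([sum_charge_ge1]), while a single
    marked element pays at most C in all ([sum_charge_le]).  Exchanging the
    sums gives the bound.

    The charge that L pays to K is a negative power of q in the difference of
    the levels; it is paid only if the level of K is at most one more than
    that of L and if, along each axis i, the midpoints differ by at most
    2 h d_i / q ^ (level K).  Here d_i is the constant of the theorem and h a
    dilation factor that is explained below.

    What makes the charges reach K is a locality property of one refinement
    ([ref_new]).  A new element is a child of an element of the closure, and
    that one is linked to a marked element by a chain along which the levels
    drop strictly.  So the patches that are crossed have distinct levels, and
    the distances add up to a convergent series of side lengths; the bound
    [reach] is at most h d_i / q ^ (level K) by [reach_le].  Now follow K back
    in time: K was created because of a marked element L1, which was created
    because of a marked element L2, and so on down to an initial element, of
    level 0.  The levels drop by at most one per step on the way from K, hence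
    an element of level one less than K, which pays 1, is met eventually.  As
    long as the charges collected so far sum to b < 1, the distance from K is
    at most (1 + b) h d_i / q ^ (level K), so that the next element on the
    way is still near enough to pay.

    Conversely, the elements of level k are cells of one grid, so at most
    the product of the numbers 4 h d_i + q ^ i of them lie near L
    ([size_near_boxes]); summing the charges over the levels is a geometric
    series.

    The dilation h is there because a child may lie almost one parent side
    length away from the patch that forced the subdivision of its parent; for
    large m this exceeds d_i / q ^ (level K), so that h = 1 would not do in
    [reach_le].  The compensation comes from the levels: an element L pays 1,
    and not q, to elements of level one more than its own.  The sum over the
    levels is then (2 q - 1) / (q - 1) instead of the q ^ 2 / (q - 1) that
    occurs in C, and this leaves room for any h with
    h ^ 3 (2 q - 1) <= q ^ 2 ([dilation]). *)

(** * Side lengths *)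

(** Axis i is cut in the step from level l to l + 1 when l is i modulo 3; this is
    the number of such l < k. *)
Definition cuts (i : 'I_3) (k : nat) : nat := (k %/ 3 + (i < k %% 3))%N.

(** The number of levels l >= k at which the side along i is still the one of
    level k; it lies between 1 and 3 since each axis is cut every third time.
    The side itself is q ^ (i - k) / q ^ (stay - 1), see [side_cbrt]. *)
Definition stay (i : 'I_3) (k : nat) : nat := (3 * cuts i k + i + 1 - k)%N.

Lemma stayE (i : 'I_3) (k : nat) : (k + stay i k = 3 * cuts i k + i + 1)%N.
Proof. by rewrite /stay /cuts; have := ltn_ord i; lia. Qed.

Lemma stay_bounds (i : 'I_3) (k : nat) : (1 <= stay i k <= 3)%N.
Proof. by rewrite /stay /cuts; have := ltn_ord i; lia. Qed.

Lemma cutsS (i : 'I_3) (k : nat) :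
  cuts i k.+1 = (cuts i k + (nat_of_ord i == k %% 3))%N.
Proof. by rewrite /cuts; have := ltn_ord i; lia. Qed.

Lemma stay_eq1 (i : 'I_3) (k : nat) : (stay i k == 1%N) = (nat_of_ord i == k %% 3)%N.
Proof. by rewrite /stay /cuts; have := ltn_ord i; lia. Qed.

Lemma stayS_cut (i : 'I_3) (k : nat) : stay i k = 1%N -> stay i k.+1 = 3%N.
Proof. by rewrite /stay /cuts; have := ltn_ord i; lia. Qed.

Lemma stayS (i : 'I_3) (k : nat) :
  stay i k != 1%N -> stay i k = (stay i k.+1).+1.
Proof. by rewrite /stay /cuts; have := ltn_ord i; lia. Qed.

Lemma sum_cuts (k : nat) : (\sum_(i < 3) cuts i k)%N = k.
Proof. by rewrite !big_ord_recl big_ord0 /cuts /= /bump /=; lia. Qed.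

Definition side (R : realType) (m : nat) (i : 'I_3) (k : nat) : R :=
  m%:R ^- cuts i k.

(** The sum of the sides along i over all levels l >= k: the current side occurs
    [stay] times, each smaller one three times, and the latter add up to
    3 side (1 / m + 1 / m ^ 2 + ...). *)
Definition side_tail (R : realType) (m : nat) (i : 'I_3) (k : nat) : R :=
  side R m i k * ((stay i k)%:R + 3 / (m%:R - 1)).

Lemma side_gt0 (R : realType) (m : nat) (i : 'I_3) (k : nat) :
  (2 <= m)%N -> 0 < side R m i k.
Proof. by move=> m2; rewrite invr_gt0 exprn_gt0// ltr0n; lia. Qed.

Lemma prod_side (R : realType) (m k : nat) : \prod_i side R m i k = m%:R ^- k.
Proof. by rewrite /side prodfV -expr_sum sum_cuts. Qed.

Lemma side_tailE (R : realType) (m : nat) (i : 'I_3) (k : nat) :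
  (2 <= m)%N -> side_tail R m i k = side R m i k + side_tail R m i k.+1.
Proof.
move=> m2; have m2R : 2 <= m%:R :> R by rewrite ler_nat.
rewrite /side_tail /side cutsS -stay_eq1.
have [s1|s1] /= := eqVneq (stay i k) 1%N.
  (* the side shrinks now and is then constant on three levels *)
  rewrite (stayS_cut s1) s1 addn1 exprSr invfM; move: (_ ^-1) => s.
  by field; rewrite subr_eq0 !gt_eqF//; lra.
by rewrite addn0 (stayS s1) -natr1; ring.
Qed.

Lemma side_tail_ge0 (R : realType) (m : nat) (i : 'I_3) (k : nat) :
  (2 <= m)%N -> 0 <= side_tail R m i k.
Proof.
move=> m2; have m2R : 2 <= m%:R :> R by rewrite ler_nat.
apply: mulr_ge0; first exact/ltW/side_gt0.
by apply: addr_ge0 => //; apply: divr_ge0; lra.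
Qed.

Lemma side_tail_anti (R : realType) (m : nat) (i : 'I_3) (k l : nat) :
  (2 <= m)%N -> (k <= l)%N -> side_tail R m i l <= side_tail R m i k.
Proof.
move=> m2; elim: l => [|l IH]; first by rewrite leqn0 => /eqP ->.
rewrite leq_eqVlt => /predU1P[-> //|]; rewrite ltnS => /IH; apply: le_trans.
by rewrite (side_tailE _ _ l m2) lerDr (ltW (side_gt0 _ _ _ m2)).
Qed.

(** * Elements as cells of anisotropic grids *)

Definition gbox (R : realType) (m k : nat) (n : 'I_3 -> nat) : box R :=
  (\row_i ((n i)%:R * side R m i k), \row_i ((n i).+1%:R * side R m i k)).

Definition grid (R : realType) (m : nat) (K : box R) : Prop :=
  exists k n, K = gbox R m k n.

Lemma level_gbox (R : realType) (m k : nat) (n : 'I_3 -> nat) :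
  (2 <= m)%N -> level m (gbox R m k n) = k.
Proof.
move=> m2; rewrite /level (@ln_vol_level _ _ k)// ?natrK// /vol -(prod_side R).
by apply: eq_bigr => i _; rewrite !mxE -natr1; ring.
Qed.

Lemma mid_gbox (R : realType) (m k : nat) (n : 'I_3 -> nat) (i : 'I_3) :
  mid (gbox R m k n) 0 i = ((n i)%:R + 1 / 2) * side R m i k.
Proof. by rewrite !mxE -natr1; field. Qed.

Lemma gboxE (R : realType) (m : nat) (K : box R) :
  (2 <= m)%N -> grid m K -> exists n, K = gbox R m (level m K) n.
Proof. by move=> m2 [k [n ->]]; exists n; rewrite level_gbox. Qed.

Lemma mid_in_box (R : realType) (m : nat) (K : box R) (x : 'rV[R]_3) (i : 'I_3) :
  (2 <= m)%N -> grid m K -> in_box K x ->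
  `|mid K 0 i - x 0 i| <= side R m i (level m K) / 2.
Proof.
move=> m2 /(gboxE m2)[n e] /(_ i); move: e.
move: (level m K) => k ->; rewrite mid_gbox !mxE -natr1 ler_norml => /andP[].
by move=> *; apply/andP; split; lra.
Qed.

Lemma slice_gbox (R : realType) (m k j : nat) (a : 'I_3) (n : 'I_3 -> nat) :
  (2 <= m)%N -> nat_of_ord a = (k %% 3)%N ->
  slice m (gbox R m k n) a j =
  gbox R m k.+1 (fun i => if i == a then (n a * m + j)%N else n i).
Proof.
move=> m2 ak; have m0 : m%:R != 0 :> R by rewrite pnatr_eq0; lia.
have sideS i : side R m i k.+1 = side R m i k / (if i == a then m%:R else 1).
  rewrite /side cutsS -ak (inj_eq val_inj); case: eqP => _ /=.
    by rewrite addn1 exprSr invfM.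
  by rewrite addn0 divr1.
rewrite /slice /gbox /=; apply: injective_projections => /=; apply/rowP => i.
  rewrite [RHS]mxE sideS mxE; case: eqP => [->|_]; last by rewrite divr1 mxE.
  by rewrite !mxE natrD natrM -natr1; move: (side _ _ _ _) => u; field.
rewrite [RHS]mxE sideS mxE; case: eqP => [->|_]; last by rewrite divr1 mxE.
by rewrite !mxE -!natr1 natrD natrM; move: (side _ _ _ _) => u; field.
Qed.

(** The m children are lined up along the cut axis, so the outermost midpoints
    are half of the difference of the sides away from the middle. *)
Lemma child_gbox (R : realType) (m : nat) (K L : box R) :
  (2 <= m)%N -> grid m K -> L \in child m K ->
  [/\ grid m L, level m L = (level m K).+1 & forall i,
    `|mid L 0 i - mid K 0 i| <=
      (side R m i (level m K) - side R m i (level m K).+1) / 2].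
Proof.
move=> m2 /(gboxE m2)[n eK] /imfsetP[j /= jm ->]; move: eK.
have m2R : 2 <= m%:R :> R by rewrite ler_nat.
move: jm; rewrite mem_iota add0n => jm.
move: (level m K) => k ->; set a : 'I_3 := inord _.
have ak : nat_of_ord a = (k %% 3)%N by rewrite inordK// ltn_mod.
rewrite (slice_gbox _ _ _ m2 ak) level_gbox//; split=> //; first by do 2 eexists.
move=> i; rewrite !mid_gbox /side cutsS -ak (inj_eq val_inj); case: eqP => [->|_].
  have jR : j.+1%:R <= m%:R :> R by rewrite ler_nat.
  have j0 : 0 <= j%:R :> R by [].
  rewrite addn1 exprSr invfM natrD natrM.
  have s0 := side_gt0 R a k m2; rewrite /side in s0; set s := (_ ^- _) in s0 *.
  have -> : ((n a)%:R * m%:R + j%:R + 1 / 2) * (s / m%:R) -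
    ((n a)%:R + 1 / 2) * s =
    (s / m%:R) * (j%:R + 1 / 2 - m%:R / 2) by field; lra.
  have -> : (s - s / m%:R) / 2 =
    (s / m%:R) * (m%:R / 2 - 1 / 2) by field; lra.
  have sm0 : 0 < s / m%:R by rewrite divr_gt0//; lra.
  rewrite normrM (gtr0_norm sm0) ler_pM2l// ler_norml -natr1 in jR *.
  by apply/andP; split; lra.
by rewrite addn0 !subrr mul0r normr0.
Qed.

(** * The constants in terms of the cube root of m *)

Definition cbrt (R : realType) (m : nat) : R := m%:R `^ (1 / 3).

Lemma powR_cbrt (R : realType) (m i : nat) :
  m%:R `^ (i%:R / 3) = cbrt R m ^+ i.
Proof. by rewrite -powR_mulrn ?powR_ge0// -powRrM; congr (_ `^ _); field. Qed.

Lemma cbrt3 (R : realType) (m : nat) : cbrt R m ^+ 3 = m%:R.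
Proof. by rewrite -powR_cbrt divff// powRr1. Qed.

Lemma cbrt_gt1 (R : realType) (m : nat) : (2 <= m)%N -> 1 < cbrt R m.
Proof.
move=> m2; rewrite ltNge; apply/negP => le1.
have : cbrt R m ^+ 3 <= 1 by rewrite exprn_ile1// powR_ge0.
by rewrite cbrt3 lern1; lia.
Qed.

Lemma d_constE (R : realType) (p : 'I_3 -> nat) (m : nat) (i : 'I_3) :
  let q := cbrt R m in
  d_const R p m i =
  q ^+ i / (1 - q^-1) * ((p i)%:R + 3 / 2 + q / 2 + (q - 1) / m%:R ^+ 2).
Proof.
rewrite /= /d_const -/(cbrt R m) powR_cbrt powRN -/(cbrt R m).
by rewrite [(3 + _) / 2]mulrDl !addrA.
Qed.

Lemma C_constE (R : realType) (p : 'I_3 -> nat) (m : nat) :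
  let q := cbrt R m in
  C_const R p m =
  q / (1 - q^-1) * \prod_(i < 3) (4 * d_const R p m i + q ^+ i).
Proof.
rewrite /= /C_const powRN -/(cbrt R m) (powR_cbrt R m 2).
have e1 : lift ord0 ord0 = 1 :> 'I_3 by exact: val_inj.
have e2 : lift ord0 (lift ord0 ord0) = 2 :> 'I_3 by exact: val_inj.
by rewrite !big_ord_recl big_ord0 mulr1 !mulrA expr0 e1 e2 expr1.
Qed.

(** The first bound on h keeps the total payment of a marked element below C,
    the second one is what [reach_le] asks for with P = p_i + 3 / 2 >= 9 / 2.
    For q <= 10 the second inequality holds with h = 1; it needs h up to 2 for
    large q, when the first one has become weak. *)
Lemma dilation (R : realType) (q : R) : 1 < q ->
  exists h : R, [/\ 1 <= h, h ^+ 3 * (2 * q - 1) <= q ^+ 2 &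
    forall P, 9 / 2 <= P -> (P + 1 / 2) / q + q - 1 <= h * (P + q / 2)].
Proof.
move=> q1.
have Pq P : 9 / 2 <= P -> 10 < q -> (P + 1 / 2) / q <= (P + 1 / 2) / 10.
  by move=> P9 q10; rewrite ler_pM2l ?lef_pV2 ?posrE; lra.
case: (lerP q 10) => q10; last case: (lerP q 16) => q16;
  [exists 1|exists (3/2)|exists 2].
- split; [lra|nra|move=> P P9].
  rewrite -lerBrDr -lerBrDr ler_pdivrMr; [nra|lra].
- split; [lra|nra|move=> P P9]; have := Pq P P9 q10; lra.
- split; [lra|nra|move=> P P9]; have := Pq P P9 q10; lra.
Qed.

(** The side stays within a factor q ^ 2 below q ^ (i - k), which scales
    uniformly with the level.  The factor q ^ i compensates for the later first
    cut and reappears in d_i. *)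
Lemma side_cbrt (R : realType) (m : nat) (i : 'I_3) (k : nat) : (2 <= m)%N ->
  let q := cbrt R m in side R m i k = q ^+ i / q ^+ k * q ^- (stay i k).-1.
Proof.
move=> m2 q; have q0 n : q ^+ n != 0.
  by rewrite expf_neq0// gt_eqF// (lt_trans ltr01)// cbrt_gt1.
have e : q ^+ k * q ^+ (stay i k).-1 = q ^+ i * q ^+ (3 * cuts i k).
  rewrite -!exprD; congr (_ ^+ _).
  by have := stayE i k; have := stay_bounds i k; lia.
rewrite /side -cbrt3 -exprM -/q -mulrA -invfM e.
by field; rewrite ?q0.
Qed.

(** Bounds the distance along i from a new element, whose parent has level k, to
    a marked element.  The three summands are the patch radii of levels above k,
    the half sides of the elements crossed, of levels k and more, and the
    distance from the parent to its child. *)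
Definition reach (R : realType) (p : 'I_3 -> nat) (m : nat) (i : 'I_3)
    (k : nat) : R :=
  ((p i)%:R + 3 / 2) * side_tail R m i k.+1 + side_tail R m i k / 2 +
  (side R m i k - side R m i k.+1) / 2.

(** Measured in units of q ^ (i - k - 1), the worst case is that of a parent which
    is cut along i: half its side and the distance to the child give up to q / 2
    each, but then the next three sides are equal and short, so that the series
    is smaller by a factor q.  This trade-off leads to (P + 1 / 2) / q + q - 1 in
    the hypothesis on h. *)
Lemma reach_le (R : realType) (p : 'I_3 -> nat) (m : nat) (i : 'I_3) (k : nat)
    (h : R) :
  let q := cbrt R m in
  (2 <= m)%N -> (3 <= p i)%N -> 1 <= h ->
  (forall P, 9 / 2 <= P -> (P + 1 / 2) / q + q - 1 <= h * (P + q / 2)) ->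
  reach R p m i k <= h * d_const R p m i / q ^+ k.+1.
Proof.
move=> q m2 p3 h1 hP; have q1 : 1 < q by exact: cbrt_gt1.
have sE l : side R m i l = q ^+ i / q ^+ l * q ^- (stay i l).-1.
  exact: side_cbrt.
have q3 : q ^+ 3 = m%:R by exact: cbrt3.
have q31 : 1 < q ^+ 3 by rewrite exprn_egt1.
have P9 : 9 / 2 <= (p i)%:R + 3 / 2 :> R.
  have : 3%:R <= (p i)%:R :> R by rewrite ler_nat.
  by lra.
rewrite d_constE -/q /reach; clearbody q.
rewrite [side_tail _ _ _ k](side_tailE _ _ _ m2).
set P := _ + 3 / 2 in P9 *; have {}hP := hP P P9.
set c := (q - 1) / _; have c0 : 0 <= c by rewrite divr_ge0 ?exprn_ge0//; lra.
set A := q ^+ i / q ^+ k.+1; have A0 : 0 < A by rewrite divr_gt0 ?exprn_gt0//; lra.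
have -> : h * (q ^+ i / (1 - q^-1) * (P + q / 2 + c)) / q ^+ k.+1 =
  A * (h * (P + q / 2 + c) / (1 - q^-1)) by rewrite /A; ring.
have u0 : 0 < 1 - q^-1 by rewrite subr_gt0 invf_lt1//; lra.
(* t stands for the tail and z for the side, in units of A; this settles the two
   cases in which the parent is not cut along i *)
have cover (t z : R) : t * (1 - q^-1) <= 1 -> 0 <= z <= 1 ->
    (P + 1 / 2) * (A * t) + A * z / 2 <= A * (h * (P + q / 2 + c) / (1 - q^-1)).
  move=> t1 /andP[z0 z1].
  have -> : (P + 1 / 2) * (A * t) + A * z / 2 =
    A * ((P + 1 / 2) * t + z / 2) by ring.
  rewrite ler_pM2l// ler_pdivlMr// mulrDl -mulrA.
  apply: (@le_trans _ _ (P + q / 2 + c)); last by rewrite ler_peMl//; lra.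
  have : (P + 1 / 2) * (t * (1 - q^-1)) <= P + 1 / 2 by rewrite ler_piMr//; lra.
  have : z / 2 * (1 - q^-1) <= 1 / 2 * (1 - q^-1) by rewrite ler_pM2r//; lra.
  have : q * q^-1 = 1 by rewrite divff// gt_eqF//; lra.
  have : 0 < q^-1 by rewrite invr_gt0; lra.
  move: (q^-1) => v *; nra.
have q0 : q != 0 by rewrite gt_eqF//; lra.
have q30 : q ^+ 3 - 1 != 0 by rewrite gt_eqF//; lra.
have sEA : side R m i k.+1 = A * q ^- (stay i k.+1).-1 by [].
have tEA : side_tail R m i k.+1 =
    A * (q ^- (stay i k.+1).-1 * ((stay i k.+1)%:R + 3 / (q ^+ 3 - 1))).
  by rewrite /side_tail sEA -q3 mulrA.
(* the parent is cut along i iff its side changes at the next level *)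
have [s1|s1] := eqVneq (stay i k) 1%N.
  have s3 := stayS_cut s1.
  have sk : side R m i k = A * q.
    rewrite sE s1 /A exprS; field; rewrite q0 expf_neq0//.
  rewrite tEA sEA s3 sk /=; set t := _ * (_ + _ / _).
  have -> : P * (A * t) + (A * q + A * t) / 2 + (A * q - A * q ^- 2) / 2 =
     A * ((P + 1 / 2) * t + q - q ^- 2 / 2) by field.
  rewrite ler_pM2l// ler_pdivlMr//.
  have -> : ((P + 1 / 2) * t + q - q ^- 2 / 2) * (1 - q^-1) =
    (P + 1 / 2) * (t * (1 - q^-1)) + q - 1 - q ^- 2 / 2 * (1 - q^-1).
    by field.
  have tq : t * (1 - q^-1) <= q^-1.
    have -> : t * (1 - q^-1) = 3 / (q ^+ 2 + q + 1).
      have q2 : q ^+ 2 + q + 1 != 0 by rewrite gt_eqF//; nra.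
      by rewrite /t; field; rewrite q0 q2.
    by rewrite ler_pdivrMr ?ler_pdivlMl; nra.
  have : (P + 1 / 2) * (t * (1 - q^-1)) <= (P + 1 / 2) / q.
    by rewrite ler_pM2l//; lra.
  have : 0 <= q ^- 2 / 2 * (1 - q^-1).
    by rewrite mulr_ge0// ?(ltW u0)// divr_ge0// invr_ge0 exprn_ge0; lra.
  have : 0 <= h * c by rewrite mulr_ge0//; lra.
  by lra.
have -> : side R m i k = side R m i k.+1.
  by rewrite /side cutsS -stay_eq1 (negPf s1) addn0.
rewrite tEA sEA; set z := q ^- _; set t := z * _.
have -> : P * (A * t) + (A * z + A * t) / 2 + (A * z - A * z) / 2 =
   (P + 1 / 2) * (A * t) + A * z / 2 by field.
have q2 : q ^+ 2 + q + 1 != 0 by rewrite gt_eqF//; nra.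
have [s2|s2] : stay i k.+1 = 1%N \/ stay i k.+1 = 2%N.
  have := stay_bounds i k.+1; have := stay_bounds i k; rewrite (stayS s1).
  by case: (stay i k.+1) => [|[|[|[]]]] //; [left|right].
  apply: cover; last by rewrite /z s2 expr0 invr1; lra.
  have -> : t * (1 - q^-1) = (q ^+ 3 + 2) / (q * (q ^+ 2 + q + 1)).
    by rewrite /t /z s2; field; rewrite q0 q2.
  by rewrite ler_pdivrMr; nra.
apply: cover; last by rewrite /z s2 expr1 invr_ge0 invf_le1; lra.
have -> : t * (1 - q^-1) = (2 * q ^+ 3 + 1) / (q ^+ 2 * (q ^+ 2 + q + 1)).
  by rewrite /t /z s2; field; rewrite q0 q2.
by rewrite ler_pdivrMr; nra.
Qed.

(** * Locality of one refinement *)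

Lemma patch_sizeE (R : realType) (p : 'I_3 -> nat) (m k : nat) (i : 'I_3) :
  patch_size R p m k 0 i = ((p i)%:R + 3 / 2) * side R m i k.
Proof.
rewrite mxE mulrC /side /cuts; case: ifP => _; last by rewrite addn0.
by rewrite addn1 exprSr invfM -mulrA [_^-1 * _]mulrC.
Qed.

Lemma patch_dist (R : realType) (X p : 'I_3 -> nat) (m : nat)
    (G : {fset box R}) (K L : box R) (i : 'I_3) :
  (2 <= m)%N -> grid m K -> K \in Defs.patch X p m G L ->
  `|mid K 0 i - mid L 0 i| <=
  ((p i)%:R + 3 / 2) * side R m i (level m L) + side R m i (level m K) / 2.
Proof.
move=> m2 gK; rewrite !inE => /andP[_ /asboolP[x [Kx [_ /(_ i)]]]].
rewrite patch_sizeE mxE distrC => /ltW xL.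
rewrite (le_trans (ler_distD (x 0 i) _ _))// addrC lerD//.
exact: mid_in_box.
Qed.

Lemma subdivs_cases (R : realType) (m : nat) (G M : {fset box R}) (K : box R) :
  K \in subdivs m G M -> K \in G \/ exists2 L, L \in M & K \in child m L.
Proof.
rewrite /subdivs; have : {subset enum_fset M <= M} by [].
elim: (enum_fset M) G => [|L s IH] G /= sM; first by left.
case/IH => [x xs|KG|//]; first by apply: sM; rewrite inE xs orbT.
  have /orP[/fsetD1P[]|] : (K \in G `\ L) || (K \in child m L) by rewrite -in_fsetU.
    by left.
  by right; exists L => //; apply: sM; rewrite mem_head.
by right.
Qed.

Lemma clos_sub (R : realType) (X p : 'I_3 -> nat) (m : nat)
    (G M : {fset box R}) : M `<=` G -> clos X p m G M `<=` G.
Proof.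
move=> MG; rewrite /clos; elim: #|` G| => //= n IH.
rewrite fsubUset IH /=; exact: fset_sub.
Qed.

(** Induction along the closure.  If K' is in the closure and K, of lower level,
    meets its patch, then K is farther from the marked element by at most the
    patch radius of K' and half a side of K.  As the levels are distinct, these
    are new terms of the two series that [side_tail] sums up. *)
Lemma clos_near (R : realType) (X p : 'I_3 -> nat) (m : nat)
    (G M : {fset box R}) (K : box R) :
  (2 <= m)%N -> (forall L, L \in G -> grid m L) ->
  K \in clos X p m G M ->
  exists L, [/\ L \in M, (level m K <= level m L)%N & forall i,
    `|mid K 0 i - mid L 0 i| <=
      ((p i)%:R + 3 / 2) * side_tail R m i (level m K).+1 +
      side_tail R m i (level m K) / 2].
Proof.
move=> m2 gG; rewrite /clos; elim: #|` G| K => /= [|n IH] K.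
  move=> KM; exists K; split=> // i; rewrite subrr normr0.
  by rewrite addr_ge0 ?divr_ge0 ?side_tail_ge0// mulr_ge0 ?side_tail_ge0// addr_ge0.
rewrite in_fsetU => /orP[/IH//|]; rewrite !inE /=.
move=> /andP[KG /hasP[K' K'n /andP[Kp lt]]].
have [L [LM le near]] := IH _ K'n; exists L; split=> // [|i].
  exact: leq_trans (ltnW lt) le.
apply: le_trans (ler_distD (mid K' 0 i) _ _) _.
have := patch_dist i m2 (gG _ KG) Kp; have := near i.
have := side_tailE R i (level m K) m2; have := side_tailE R i (level m K') m2.
have := side_tail_anti R i m2 lt.
have P0 : 0 <= (p i)%:R + 3 / 2 :> R by rewrite addr_ge0// divr_ge0.
move=> anti eK' eK nearK' nearK.
have := ler_wpM2l P0 anti; rewrite eK' in nearK' *.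
by lra.
Qed.

Lemma ref_grid (R : realType) (X p : 'I_3 -> nat) (m : nat)
    (G M : {fset box R}) :
  (2 <= m)%N -> M `<=` G -> (forall K, K \in G -> grid m K) ->
  forall K, K \in ref X p m G M -> grid m K.
Proof.
move=> m2 MG gG K /subdivs_cases[/gG//|[L Lc /child_gbox[]//]].
by apply: gG; apply: (fsubsetP (clos_sub X p m MG)).
Qed.

Lemma ref_new (R : realType) (X p : 'I_3 -> nat) (m : nat)
    (G M : {fset box R}) (K : box R) :
  (2 <= m)%N -> M `<=` G -> (forall L, L \in G -> grid m L) ->
  K \in ref X p m G M -> K \notin G ->
  (0 < level m K)%N /\
  exists L, [/\ L \in M, (level m K <= (level m L).+1)%N & forall i,
    `|mid K 0 i - mid L 0 i| <= reach R p m i (level m K).-1].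
Proof.
move=> m2 MG gG /subdivs_cases[-> //|[K' K'c KK']] _.
have gK' : grid m K' by apply: gG; apply: (fsubsetP (clos_sub X p m MG)).
have [_ lK near1] := child_gbox m2 gK' KK'.
have [L [LM le near2]] := clos_near m2 gG K'c.
rewrite lK; split=> //; exists L; split=> // i.
apply: le_trans (ler_distD (mid K' 0 i) _ _) _.
by rewrite /reach addrC lerD.
Qed.

(** * Counting the grid cells near a point *)

Lemma size_near (R : realType) (s : seq nat) (w W y : R) :
  0 < w -> 0 <= W -> uniq s ->
  (forall n, n \in s -> `|(n%:R + 1 / 2) * w - y| <= W) ->
  (size s)%:R <= 2 * W / w + 1.
Proof.
move=> w0 W0 us near; have B0 : 0 <= 2 * W / w by rewrite divr_ge0 ?mulr_ge0// ltW.
have [s0|[n0 n0s]] : s = [::] \/ exists n, n \in s.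
    by case: (s) => [|n s']; [left|right; exists n; rewrite mem_head].
  by rewrite s0 addr_ge0.
have ex : exists n, n \in s by exists n0.
case: (ex_minnP ex) => a a_s a_min.
have sub : {subset s <= iota a (Num.truncn (2 * W / w)).+1}.
  move=> n ns; rewrite mem_iota a_min//= addnS ltnS -leq_subLR.
  rewrite truncn_ge_nat// natrB ?a_min// ler_pdivlMr//.
  have := near n ns; have := near a a_s; rewrite !ler_norml.
  by move=> /andP[? ?] /andP[? ?]; lra.
have := uniq_leq_size us sub; rewrite size_iota -(ler_nat R) -natr1.
by move/le_trans; apply; rewrite lerD2r truncn_le.
Qed.

(** A cell of the grid is determined by its three positions. *)
Lemma size_near_boxes (R : realType) (m k : nat) (A : seq (box R))
    (y W : 'I_3 -> R) :
  (2 <= m)%N -> (forall i, 0 <= W i) -> uniq A ->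
  (forall K, K \in A -> grid m K /\ level m K = k /\
    forall i, `|mid K 0 i - y i| <= W i) ->
  (size A)%:R <= \prod_(i < 3) (2 * W i / side R m i k + 1).
Proof.
move=> m2 W0 uA near.
(* the corner is exactly a multiple of the side, so truncation recovers it *)
pose pos (i : 'I_3) (K : box R) := Num.truncn (K.1 0 i / side R m i k).
have posP K : K \in A -> K = gbox R m k (pos^~ K).
  move=> /near[/(gboxE m2)[n eK] [lK _]]; rewrite lK in eK; rewrite {1}eK.
  congr gbox; apply/funext => i.
  by rewrite /pos eK mxE mulfK ?natrK// gt_eqF ?side_gt0.
pose S i := undup [seq pos i K | K <- A].
have sizeS i : (size (S i))%:R <= 2 * W i / side R m i k + 1.
  apply: (@size_near _ _ _ _ (y i)); rewrite ?side_gt0 ?undup_uniq// => n.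
  rewrite mem_undup => /mapP[K KA ->]; have [_ [_ /(_ i)]] := near _ KA.
  by rewrite {1}(posP _ KA) mid_gbox.
pose f K := (pos ord0 K, (pos (lift ord0 ord0) K,
  pos (lift ord0 (lift ord0 ord0)) K)).
have uf : uniq [seq f K | K <- A].
  rewrite map_inj_in_uniq// => K L KA LA [e0 e1 e2].
  rewrite (posP _ KA) (posP _ LA); congr gbox; apply/funext => i.
  by case: i => [[|[|[|//]]] lt]; [move: e0|move: e1|move: e2];
    congr (pos _ _ = pos _ _); exact: val_inj.
have sub : {subset [seq f K | K <- A] <=
    [seq (a, b) | a <- S ord0, b <- [seq (c, d) | c <- S (lift ord0 ord0),
      d <- S (lift ord0 (lift ord0 ord0))]]}.
  move=> _ /mapP[K KA ->]; rewrite /f.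
  by do 2?[apply: allpairs_f]; rewrite mem_undup map_f.
have := uniq_leq_size uf sub; rewrite size_map !size_allpairs -(ler_nat R).
move/le_trans; apply; rewrite !big_ord_recl big_ord0 mulr1 !natrM.
by apply: ler_pM; rewrite ?mulr_ge0 ?sizeS//; apply: ler_pM; rewrite ?sizeS.
Qed.

(** * The charging argument *)

(** The truncated subtraction is essential: the exponent is 0, and the charge 1,
    when the level of K is one more than that of L. *)
Definition charge (R : realType) (m : nat) (eps : 'I_3 -> R) (K L : box R) : R :=
  let q := cbrt R m in
  if (level m K <= (level m L).+1)%N &&
     [forall i, `|mid K 0 i - mid L 0 i| <= 2 * eps i / q ^+ level m K]
  then q ^- (level m L - level m K) else 0.

Lemma charge_ge0 (R : realType) (m : nat) (eps : 'I_3 -> R) (K L : box R) :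
  0 <= charge m eps K L.
Proof.
by rewrite /charge; case: ifP => // _; rewrite invr_ge0 exprn_ge0 ?powR_ge0.
Qed.

(** The hypothesis that elements created at step j lie near an element of M j is
    applied backwards in time.  Each step of the way uses marked elements of an
    earlier mesh, so no charge is counted twice. *)
Lemma sum_charge_ge1 (R : realType) (m : nat) (eps : 'I_3 -> R) (J : nat)
    (G M : nat -> {fset box R}) :
  (2 <= m)%N -> (forall i, 0 <= eps i) ->
  (forall K, K \in G 0%N -> level m K = 0%N) ->
  (forall j, (j < J)%N -> M j `<=` G j) ->
  (forall j K, (j < J)%N -> K \in G j.+1 -> K \notin G j ->
    exists L, [/\ L \in M j, (level m K <= (level m L).+1)%N & forall i,
      `|mid K 0 i - mid L 0 i| <= eps i / cbrt R m ^+ level m K]) ->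
  forall K, K \in G J -> (0 < level m K)%N ->
    1 <= \sum_(j < J) \sum_(L <- M j) charge m eps K L.
Proof.
move=> m2 eps0 G0 MG new K KJ lK.
set q := cbrt R m; have q1 : 1 < q by exact: cbrt_gt1.
have q0 : 0 < q by exact: lt_trans ltr01 q1.
(* K' is the element reached at time n, and b bounds the distance covered; it is
   the sum of the charges that have been collected after time n *)
suff budget n K' (b : R) : (n <= J)%N -> 0 <= b < 1 -> K' \in G n ->
    (level m K <= level m K')%N ->
    (forall i, `|mid K 0 i - mid K' 0 i| + eps i / q ^+ level m K' <=
      (1 + b) * (eps i / q ^+ level m K)) ->
    1 - b <= \sum_(j < n) \sum_(L <- M j) charge m eps K L.
  rewrite -[leLHS]subr0; apply: (budget J K) => // [|i]; first by rewrite lexx ltr01.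
  by rewrite subrr normr0 add0r addr0 mul1r.
elim: n K' b => [|n IH] K' b nJ /andP[b0 b1] K'n lKK' near.
  by move: lKK'; rewrite (G0 K')// leqn0 => /eqP lK0; rewrite lK0 in lK.
rewrite big_ord_recr /=.
have sum0 : 0 <= \sum_(L <- M n) charge m eps K L.
  by rewrite sumr_ge0// => L _; exact: charge_ge0.
have [K'G|K'G] := boolP (K' \in G n).
  by apply: le_trans (IH K' b (ltnW nJ) _ K'G lKK' near) _; rewrite ?b0 ?lerDl.
have [L [LM lL nearL]] := new n K' nJ K'n K'G.
set w : R := q ^- (level m L - level m K).
have chargeE : charge m eps K L = w.
  rewrite /charge (leq_trans lKK' lL) /= ifT//; apply/forallP => i.
  apply: le_trans (ler_distD (mid K' 0 i) _ _) _.
  apply: le_trans (lerD (lexx _) (nearL i)) _; apply: le_trans (near i) _.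
  rewrite -mulrA ler_wpM2r//; last by lra.
  by rewrite divr_ge0// exprn_ge0// ltW.
have w_le : w <= \sum_(L <- M n) charge m eps K L.
  rewrite (big_rem L)//= chargeE lerDl sumr_ge0// => L' _; exact: charge_ge0.
(* either the charge of L completes the sum, or L takes the place of K' *)
have [bw|bw] := lerP 1 (b + w).
  have : 0 <= \sum_(j < n) \sum_(L <- M j) charge m eps K L.
    by do 2![apply: sumr_ge0 => ? _]; exact: charge_ge0.
  by lra.
have lKL : (level m K <= level m L)%N.
  rewrite leqNgt; apply/negP => lt; move: bw; rewrite /w.
  have -> : (level m L - level m K = 0)%N by apply/eqP; rewrite subn_eq0 ltnW.
  by rewrite expr0 invr1; lra.
have w0 : 0 <= w by rewrite invr_ge0 exprn_ge0// ltW.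
suff : 1 - (b + w) <= \sum_(j < n) \sum_(L <- M j) charge m eps K L by lra.
apply: (IH L) => [||||i]; [exact: ltnW|by rewrite addr_ge0| |by []|].
  exact: (fsubsetP (MG n nJ)).
have -> : eps i / q ^+ level m L = w * (eps i / q ^+ level m K).
  by rewrite /w -{1}(subnK lKL) exprD invfM; ring.
rewrite addrA mulrDl lerD2r; apply: le_trans (near i).
exact: le_trans (ler_distD (mid K' 0 i) _ _) (lerD (lexx _) (nearL i)).
Qed.

(** The total of the payments over the levels 0, ..., l + 1, with payment 1 both
    at level l and at level l + 1. *)
Lemma sum_geometric (R : realType) (q : R) (l : nat) : 1 < q ->
  \sum_(k < l.+2) q ^- (l - k) <= (2 * q - 1) / (q - 1).
Proof.
move=> q1; have q0 : q != 0 by rewrite gt_eqF//; lra.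
have V n : \sum_(k < n.+1) q ^- (n - k) <= q / (q - 1).
  elim: n => [|n IH].
    by rewrite big_ord_recl big_ord0 subnn expr0 invr1 ler_pdivlMr; lra.
  rewrite big_ord_recr /= subnn expr0 invr1.
  under eq_bigr => k _ do rewrite subSn -1?ltnS// exprS invfM.
  rewrite -mulr_sumr.
  have : q^-1 * (\sum_(k < n.+1) q ^- (n - k)) <= q^-1 * (q / (q - 1)).
    by rewrite ler_pM2l// invr_gt0; lra.
  move/(lerD)/(_ (lexx 1))/le_trans; apply.
  rewrite le_eqVlt; apply/orP; left; apply/eqP; field.
  by rewrite q0 gt_eqF//; lra.
rewrite big_ord_recr /=; have -> : (l - l.+1 = 0)%N by lia.
rewrite expr0 invr1; apply: le_trans (lerD (V l) (lexx 1)) _.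
rewrite le_eqVlt; apply/orP; left; apply/eqP; field.
by rewrite gt_eqF//; lra.
Qed.

Lemma d_const_ge0 (R : realType) (p : 'I_3 -> nat) (m : nat) (i : 'I_3) :
  (2 <= m)%N -> 0 <= d_const R p m i.
Proof.
move=> m2; have q1 := cbrt_gt1 R m2.
rewrite d_constE mulr_ge0 ?divr_ge0 ?exprn_ge0 ?powR_ge0 ?subr_ge0 ?invf_le1//;
  try lra.
by rewrite !addr_ge0 ?divr_ge0 ?exprn_ge0 ?powR_ge0//; lra.
Qed.

Lemma side_cbrt_le (R : realType) (m : nat) (i : 'I_3) (k : nat) :
  (2 <= m)%N -> cbrt R m ^+ k * side R m i k <= cbrt R m ^+ i.
Proof.
move=> m2; have q1 := cbrt_gt1 R m2.
have q0 : 0 < cbrt R m by exact: lt_trans ltr01 q1.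
rewrite side_cbrt// mulrA [_ ^+ k * _]mulrC divfK ?expf_neq0 ?gt_eqF//.
by rewrite ler_piMr ?exprn_ge0 ?(ltW q0)// invf_le1 ?exprn_gt0// exprn_ege1// ltW.
Qed.

(** The number of cells of level k near L is at most the product of the factors
    (4 h d_i + q ^ k side_i) / (q ^ k side_i), whose denominators multiply to 1
    as a cell of level k has volume q ^ (- 3 k). *)
Lemma sum_charge_le (R : realType) (p : 'I_3 -> nat) (m : nat) (h : R)
    (A : seq (box R)) (L : box R) :
  let q := cbrt R m in
  (2 <= m)%N -> 1 <= h -> h ^+ 3 * (2 * q - 1) <= q ^+ 2 ->
  uniq A -> (forall K, K \in A -> grid m K) ->
  \sum_(K <- A) charge m (fun i => h * d_const R p m i) K L <= C_const R p m.
Proof.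
move=> q m2 h1 hq uA gA; have q1 : 1 < q by exact: cbrt_gt1.
have q0 : 0 < q by exact: lt_trans ltr01 q1.
pose eps i := h * d_const R p m i.
have d0 i : 0 <= d_const R p m i by exact: d_const_ge0.
have eps0 i : 0 <= eps i by rewrite mulr_ge0//; lra.
have q0n n : 0 <= q ^+ n by rewrite exprn_ge0// ltW.
have reach0 k i : 0 <= 2 * eps i / q ^+ k.
  by apply: divr_ge0 => //; exact: mulr_ge0.
have eps4 i : 0 <= 4 * eps i by exact: mulr_ge0.
have d4 i : 0 <= 4 * d_const R p m i by exact: mulr_ge0.
pose near k K := (level m K == k) &&
  [forall i, `|mid K 0 i - mid L 0 i| <= 2 * eps i / q ^+ k].
set D := \prod_(i < 3) (4 * eps i + q ^+ i).
have count k : (size [seq K <- A | near k K])%:R <= D.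
  apply: le_trans (@size_near_boxes _ _ k _ (fun i => mid L 0 i)
    (fun i => 2 * eps i / q ^+ k) m2 _ _ _) _.
  - by move=> i; exact: reach0.
  - exact: filter_uniq.
  - move=> K; rewrite mem_filter => /andP[/andP[/eqP lK /forallP nK] KA].
    by split; [exact: gA|split].
  have -> : \prod_(i < 3) (2 * (2 * eps i / q ^+ k) / side R m i k + 1) =
      \prod_(i < 3) (4 * eps i + q ^+ k * side R m i k).
    have -> : \prod_(i < 3) (2 * (2 * eps i / q ^+ k) / side R m i k + 1) =
      \prod_(i < 3) ((4 * eps i + q ^+ k * side R m i k) / (q ^+ k * side R m i k)).
      apply: eq_bigr => i _; have sn0 : side R m i k != 0.
        by rewrite gt_eqF// side_gt0.
      have qn0 : q ^+ k != 0 by rewrite expf_neq0// gt_eqF.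
      by field; rewrite sn0 qn0.
    have one : \prod_(i < 3) (q ^+ k * side R m i k) = 1.
      rewrite big_split /= prodr_const card_ord prod_side -exprM mulnC exprM cbrt3.
      by rewrite divff// expf_neq0// pnatr_eq0; lia.
    by rewrite big_split /= prodfV one invr1 mulr1.
  apply: ler_prod => i _; rewrite lerD2l side_cbrt_le// andbT.
  by rewrite addr_ge0// mulr_ge0// ltW// side_gt0.
have chargeE K : charge m eps K L <=
    \sum_(k < (level m L).+2) q ^- (level m L - k) * (near k K)%:R.
  rewrite /charge; case: ifP => [/andP[lK nK]|_]; last first.
    by rewrite sumr_ge0// => k _; rewrite mulr_ge0// invr_ge0.
  rewrite (bigD1 (Ordinal (lK : (level m K < (level m L).+2)%N)))//=.
  rewrite /near eqxx nK mulr1 lerDl sumr_ge0// => k _.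
  by rewrite mulr_ge0// invr_ge0.
apply: le_trans (ler_sum _ (fun K _ => chargeE K)) _.
rewrite exchange_big /=.
have D0 : 0 <= D by exact: le_trans (count 0%N).
apply: (@le_trans _ _ (\sum_(k < (level m L).+2) q ^- (level m L - k) * D)).
  apply: ler_sum => k _; rewrite -mulr_sumr ler_wpM2l//.
    by rewrite invr_ge0.
  apply: le_trans (count k); rewrite size_filter -sum1_count natr_sum.
  rewrite [leRHS]big_mkcond /=; apply: ler_sum => K _.
  by case: (near k K).
rewrite -mulr_suml.
have P0 : 0 <= \prod_(i < 3) (4 * d_const R p m i + q ^+ i).
  by apply: prodr_ge0 => i _; rewrite addr_ge0.
have DP : D <= h ^+ 3 * \prod_(i < 3) (4 * d_const R p m i + q ^+ i).
  rewrite -[X in h ^+ X](card_ord 3) -prodr_const -big_split /=.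
  apply: ler_prod => i _; apply/andP; split.
    by rewrite addr_ge0.
  by rewrite mulrDr mulrCA lerD2l ler_peMl.
rewrite C_constE -/q.
apply: le_trans (ler_pM _ D0 (sum_geometric _ q1) DP) _.
  by rewrite sumr_ge0// => k _; rewrite invr_ge0.
rewrite mulrA ler_wpM2r//.
have -> : q / (1 - q^-1) = q ^+ 2 / (q - 1).
  by field; rewrite !gt_eqF//; lra.
rewrite mulrAC ler_pM2r 1?mulrC//.
by rewrite invr_gt0; lra.
Qed.

Theorem theorem7p1 (R : realType) (X p : 'I_3 -> nat) (m J : nat)
    (G M : nat -> {fset box R}) :
  (forall i, (0 < X i)%N) ->
  (forall i, (3 <= p i)%N && odd (p i)) ->
  (2 <= m)%N ->
  G 0%N = initial_mesh R X ->
  (forall j, (j <= J)%N -> admissible X p m (G j)) ->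
  (forall j, (j < J)%N -> M j `<=` G j) ->
  (forall j, (j < J)%N -> G j.+1 = ref X p m (G j) (M j)) ->
  (#|` G J `\` G 0%N|)%:R <= C_const R p m * (\sum_(j < J) #|` M j|)%:R.
Proof.
move=> _ p_odd m2 G0 _ MG GS.
have p3 i : (3 <= p i)%N by case/andP: (p_odd i).
have [h [h1 hq hP]] := dilation (cbrt_gt1 R m2).
have G0_box K : K \in G 0%N -> exists n, K = gbox R m 0 n.
  rewrite G0 => /imfsetP[c _ ->]; exists (fun i => nat_of_ord (c i)).
  by apply: injective_projections; apply/rowP => i;
    rewrite !mxE /side expr0 invr1 mulr1.
have gG j : (j <= J)%N -> forall K, K \in G j -> grid m K.
  elim: j => [_ K /G0_box[n ->]|j IH jJ]; first by do 2 eexists.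
  by rewrite GS//; apply: ref_grid (MG j jJ) (IH (ltnW jJ)).
have new_pos j K : (j <= J)%N -> K \in G j -> K \notin G 0%N -> (0 < level m K)%N.
  elim: j => [_ -> //|j IH jJ KS K0].
  have [Kj|Kj] := boolP (K \in G j); first exact: IH (ltnW jJ) Kj K0.
  by rewrite GS// in KS; have [] := ref_new m2 (MG j jJ) (gG j (ltnW jJ)) KS Kj.
pose eps i := h * d_const R p m i.
have eps0 i : 0 <= eps i by rewrite mulr_ge0 ?d_const_ge0//; lra.
have charged K : K \in G J `\` G 0%N ->
    1 <= \sum_(j < J) \sum_(L <- M j) charge m eps K L.
  rewrite inE => /andP[K0 KJ]; apply: sum_charge_ge1 KJ (new_pos J K _ KJ K0) => //.
    by move=> K' /G0_box[n ->]; rewrite level_gbox.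
  move=> j K' jJ; rewrite GS// => KS Kj.
  have [lK [L [LM lL near]]] := ref_new m2 (MG j jJ) (gG j (ltnW jJ)) KS Kj.
  exists L; split=> // i; apply: le_trans (near i) _.
  by have := reach_le (level m K').-1 m2 (p3 i) h1 hP; rewrite prednK.
rewrite -sum1_size natr_sum.
apply: (@le_trans _ _ (\sum_(K <- G J `\` G 0%N) \sum_(j < J)
    \sum_(L <- M j) charge m eps K L)).
  by rewrite [leLHS]big_seq [leRHS]big_seq; apply: ler_sum.
rewrite exchange_big /= natr_sum mulr_sumr; apply: ler_sum => j _.
rewrite exchange_big /= -sum1_size natr_sum mulr_sumr; apply: ler_sum => L _.
rewrite mulr1; apply: sum_charge_le => // [|K]; first exact: fset_uniq.
by rewrite inE => /andP[_]; exact: gG.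
Qed.
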